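(* Let $\lambda_v>0$, $r_v>0$, $\rho_v=\lambda_v/r_v$ for $v\in V$, and assume $\sum_{v'\in\bar{\mathcal A}(v)}\rho_{v'}<1$ for all $v\in V$. Under the proportional fair allocation, $N(t)$ is a reversible, positive recurrent Markov process with stationary distribution $$\pi(n)=\frac{1}{c(\rho)}\prod_{v\in V}\rho_v^{n_v}\binom{\sum_{v'\in\bar{\mathcal D}(v)}n_{v'}}{n_v},\qquad n\in\mathbb N^{V},$$ where $$c(\rho)=\prod_{v\in V}\frac{1-\sum_{v'\in\mathcal A(v)}\rho_{v'}}{1-\sum_{v'\in\bar{\mathcal A}(v)}\rho_{v'}}.$$ Moreover, in stationarity, for every $v\in V$, $$\mathbb E[N_v(t)]=\rho_v\sum_{v'\in\bar{\mathcal D}(v)}\frac{1-d(v')}{1-\sum_{v''\in\bar{\mathcal A}(v')}\rho_{v''}},\qquad \psi_v=\frac{\lambda_v}{\mathbb E[N_v(t)]}=r_v\Big[\sum_{v'\in\bar{\mathcal D}(v)}\frac{1-d(v')}{1-\sum_{v''\in\bar{\mathcal A}(v')}\rho_{v''}}\Big]^{-1}.$$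
   Context: $G=(V,E)$ is a finite directed rooted tree with vertex set $V=\{1,\dots,|V|\}$ and root $1$, edges oriented from parent to child. For $v\in V$: $\mathcal A(v)$ is the set of strict ancestors of $v$, $\bar{\mathcal A}(v)=\mathcal A(v)\cup\{v\}$, $\mathcal D(v)$ is the set of strict descendants of $v$, $\bar{\mathcal D}(v)=\mathcal D(v)\cup\{v\}$, and $d(v)$ is the number of children of $v$. $N(t)\in\mathbb N^V$ is the continuous-time Markov chain with transition rates $n\to n+e^v$ at rate $\lambda_v$ and $n\to n-e^v$ at rate $r_v\gamma_v(n)\mathbf 1\{n_v\ge1\}$ ($e^v$ the $v$-th canonical basis vector). The proportional fair allocation is $\gamma_v(n)=\frac{n_v}{\sum_{v'\in\bar{\mathcal D}(v)}n_{v'}}\prod_{a\in\mathcal A(v)}\frac{\sum_{v'\in\mathcal D(a)}n_{v'}}{\sum_{v'\in\bar{\mathcal D}(a)}n_{v'}}$ when $n_v\ge1$ (all denominators are then positive) and $\gamma_v(n)=0$ when $n_v=0$. $\psi_v=\lambda_v/\mathbb E[N_v(t)]$ is the flow throughput of beam $v$. *)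

(* Defs.v *)
(* classical reals.  Vertices are 0,...,K-1 with root 0
   (the paper's vertex i corresponds to i-1 here); the tree is given by a
   parent function [par] (the value [par 0] is irrelevant). *)
From Stdlib Require Import Reals List Arith Bool Relations.
Import ListNotations.
Open Scope R_scope.

Definition vsum (K : nat) (f : nat -> R) : R :=
  fold_right (fun v acc => f v + acc) 0 (seq 0 K).
Definition vprod (K : nat) (f : nat -> R) : R :=
  fold_right (fun v acc => f v * acc) 1 (seq 0 K).
Definition vsumn (K : nat) (f : nat -> nat) : nat :=
  fold_right (fun v acc => (f v + acc)%nat) 0%nat (seq 0 K).

Definition is_tree (K : nat) (par : nat -> nat) : Prop :=
  (1 <= K)%nat /\
  (forall v, (0 < v < K)%nat -> (par v < K)%nat) /\
  (forall v, (v < K)%nat -> exists k, Nat.iter k par v = 0%nat).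

(* a is a strict ancestor of v: a = par^k(v) for some k >= 1 such that
   the path v, par v, ..., par^(k-1) v does not pass through the root.
   (For a tree with K vertices, depth < K, so k ranges over 1..K.) *)
Definition is_anc (K : nat) (par : nat -> nat) (a v : nat) : bool :=
  existsb (fun k => Nat.eqb (Nat.iter k par v) a &&
                    forallb (fun j => negb (Nat.eqb (Nat.iter j par v) 0))
                            (seq 0 k))
          (seq 1 K).

Definition is_anc_eq (K : nat) (par : nat -> nat) (a v : nat) : bool :=
  Nat.eqb a v || is_anc K par a v.

Definition nchildren (K : nat) (par : nat -> nat) (v : nat) : nat :=
  length (filter (fun c => negb (Nat.eqb c 0) && Nat.eqb (par c) v) (seq 0 K)).

(* states: n : nat -> nat, supported on V *)
Definition valid (K : nat) (n : nat -> nat) : Prop :=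
  forall u, (K <= u)%nat -> n u = 0%nat.

Definition subtot (K : nat) (par : nat -> nat) (n : nat -> nat) (u : nat) : nat :=
  vsumn K (fun d => if is_anc_eq K par u d then n d else 0%nat).

Definition gamma (K : nat) (par : nat -> nat) (n : nat -> nat) (v : nat) : R :=
  if Nat.eqb (n v) 0 then 0
  else INR (n v) / INR (subtot K par n v) *
       vprod K (fun a => if is_anc K par a v
                         then INR (subtot K par n a - n a) / INR (subtot K par n a)
                         else 1).

Definition incr (n : nat -> nat) (v : nat) : nat -> nat :=
  fun u => if Nat.eqb u v then (n u + 1)%nat else n u.
Definition decr (n : nat -> nat) (v : nat) : nat -> nat :=
  fun u => if Nat.eqb u v then (n u - 1)%nat else n u.

Definition state_eqb (K : nat) (n m : nat -> nat) : bool :=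
  forallb (fun u => Nat.eqb (n u) (m u)) (seq 0 K).

Definition rate (K : nat) (par : nat -> nat) (lam r : nat -> R)
    (n m : nat -> nat) : R :=
  vsum K (fun v =>
    (if state_eqb K m (incr n v) then lam v else 0) +
    (if negb (Nat.eqb (n v) 0) && state_eqb K m (decr n v)
     then r v * gamma K par n v else 0)).

Definition out_rate (K : nat) (par : nat -> nat) (lam r : nat -> R)
    (n : nat -> nat) : R :=
  vsum K (fun v => lam v + r v * gamma K par n v).

Definition stationary (K : nat) (par : nat -> nat) (lam r : nat -> R)
    (p : (nat -> nat) -> R) : Prop :=
  forall m, valid K m ->
    p m * out_rate K par lam r m =
    vsum K (fun v =>
      (if Nat.eqb (m v) 0 then 0
       else p (decr m v) * rate K par lam r (decr m v) m) +
      p (incr m v) * rate K par lam r (incr m v) m).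

Definition reversible (K : nat) (par : nat -> nat) (lam r : nat -> R)
    (p : (nat -> nat) -> R) : Prop :=
  forall n m, valid K n -> valid K m ->
    p n * rate K par lam r n m = p m * rate K par lam r m n.

Definition step (K : nat) (par : nat -> nat) (lam r : nat -> R)
    (n m : nat -> nat) : Prop :=
  valid K n /\ valid K m /\ rate K par lam r n m > 0.
Definition irreducible (K : nat) (par : nat -> nat) (lam r : nat -> R) : Prop :=
  forall n m, valid K n -> valid K m ->
    clos_refl_trans _ (step K par lam r) n m.

(* Box partial sums over N^V: sum of f(n) over n with n_u <= M for u < d,
   n_u = 0 for u >= d. *)
Definition upd (n : nat -> nat) (d j : nat) : nat -> nat :=
  fun u => if Nat.eqb u d then j else n u.
Fixpoint bsum (d M : nat) (f : (nat -> nat) -> R) : R :=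
  match d with
  | O => f (fun _ => 0%nat)
  | S d' => fold_right (fun j acc => bsum d' M (fun n => f (upd n d' j)) + acc)
                       0 (seq 0 (S M))
  end.

(* sum over N^V of a nonnegative family f equals L *)
Definition state_sum (K : nat) (f : (nat -> nat) -> R) (L : R) : Prop :=
  Un_cv (fun M => bsum K M f) L.

Definition sumA (K : nat) (par : nat -> nat) (rho : nat -> R) (v : nat) : R :=
  vsum K (fun a => if is_anc K par a v then rho a else 0).
Definition sumAbar (K : nat) (par : nat -> nat) (rho : nat -> R) (v : nat) : R :=
  vsum K (fun a => if is_anc_eq K par a v then rho a else 0).

Definition c_rho (K : nat) (par : nat -> nat) (rho : nat -> R) : R :=
  vprod K (fun v => (1 - sumA K par rho v) / (1 - sumAbar K par rho v)).

Definition pi_pf (K : nat) (par : nat -> nat) (rho : nat -> R)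
    (n : nat -> nat) : R :=
  / c_rho K par rho *
  vprod K (fun v => rho v ^ (n v) * C (subtot K par n v) (n v)).

Definition Ssub (K : nat) (par : nat -> nat) (rho : nat -> R) (v : nat) : R :=
  vsum K (fun w => if is_anc_eq K par v w
                   then (1 - INR (nchildren K par w)) / (1 - sumAbar K par rho w)
                   else 0).

(* Main.v *)
Require Import Defs.
From Stdlib Require Import Reals Lra Lia List Permutation Arith Bool
  FunctionalExtensionality Relations Classical Sorting.Sorted.
Import ListNotations.
Open Scope R_scope.

(* Detailed balance is a one-line identity: adding a customer at v multiplies
   the product form by rho_v and by binomial ratios at v and at its ancestors,
   and these ratios are exactly the factors of the proportional fair share
   gamma_v.  Stationarity follows, and irreducibility holds because every state
   can be emptied and refilled one customer at a time.

   The normalising constant and the means are obtained by summing out the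
   coordinates of N^V one vertex at a time, ancestors first (Tonelli).  Once the
   ancestors of w are summed out, the terms involving n_w are
   C(n_w + s, n_w) z^n_w with z = rho_w / (1 - A_w), where s is the load of the
   strict subtree of w and A_w the load of rho on the ancestors of w.  The
   negative binomial series gives (1 - z)^-(s+1), i.e. the factor
   (1 - A_w) / (1 - A_w - rho_w) of c(rho) at w, together with a rescaling of
   rho on the subtree of w.  The same computation weighted by n_v yields the
   mean, after a reindexing of the strict descendants of v by their parents,
   which is where the numbers of children d(v') come from. *)

Definition lsum (l : list nat) (f : nat -> R) : R :=
  fold_right (fun v acc => f v + acc) 0 l.
Definition lprod (l : list nat) (f : nat -> R) : R :=
  fold_right (fun v acc => f v * acc) 1 l.
Definition lsumn (l : list nat) (f : nat -> nat) : nat :=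
  fold_right (fun v acc => (f v + acc)%nat) 0%nat l.

Lemma lsum_ext l f g : (forall x, In x l -> f x = g x) -> lsum l f = lsum l g.
Proof. induction l; simpl; intros H; [reflexivity|]. f_equal; auto. Qed.
Lemma lprod_ext l f g : (forall x, In x l -> f x = g x) -> lprod l f = lprod l g.
Proof. induction l; simpl; intros H; [reflexivity|]. f_equal; auto. Qed.
Lemma lsumn_ext l f g : (forall x, In x l -> f x = g x) -> lsumn l f = lsumn l g.
Proof. induction l; simpl; intros H; [reflexivity|]. f_equal; auto. Qed.

Lemma lsum_plus l f g : lsum l (fun x => f x + g x) = lsum l f + lsum l g.
Proof. induction l; simpl; try rewrite IHl; lra. Qed.
Lemma lsum_minus l f g : lsum l (fun x => f x - g x) = lsum l f - lsum l g.
Proof. induction l; simpl; try rewrite IHl; lra. Qed.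
Lemma lsum_scal l c f : lsum l (fun x => c * f x) = c * lsum l f.
Proof. induction l; simpl; try rewrite IHl; lra. Qed.
Lemma lsum_zero l : lsum l (fun _ => 0) = 0.
Proof. induction l; simpl; try rewrite IHl; lra. Qed.
Lemma lsum_app l1 l2 f : lsum (l1 ++ l2) f = lsum l1 f + lsum l2 f.
Proof. induction l1; simpl; try rewrite IHl1; lra. Qed.
Lemma lprod_mult l f g : lprod l (fun x => f x * g x) = lprod l f * lprod l g.
Proof. induction l; simpl; try rewrite IHl; ring. Qed.
Lemma lprod_one l : lprod l (fun _ => 1) = 1.
Proof. induction l; simpl; try rewrite IHl; ring. Qed.
Lemma lprod_pow l (x : R) g : lprod l (fun v => x ^ g v) = x ^ lsumn l g.
Proof. induction l; simpl; auto. rewrite IHl, pow_add. ring. Qed.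
Lemma INR_lsumn l g : INR (lsumn l g) = lsum l (fun t => INR (g t)).
Proof. induction l; simpl; auto. rewrite plus_INR, IHl. auto. Qed.

Lemma lsum_nonneg l f : (forall x, In x l -> 0 <= f x) -> 0 <= lsum l f.
Proof.
  induction l; simpl; intros H; [lra|].
  pose proof (H a (or_introl eq_refl)). assert (0 <= lsum l f) by auto. lra.
Qed.
Lemma lsum_le l f g : (forall x, In x l -> f x <= g x) -> lsum l f <= lsum l g.
Proof.
  induction l; simpl; intros H; [lra|].
  pose proof (H a (or_introl eq_refl)). assert (lsum l f <= lsum l g) by auto. lra.
Qed.
Lemma lprod_pos l f : (forall x, In x l -> 0 < f x) -> 0 < lprod l f.
Proof. induction l; simpl; intros H; [lra|]. apply Rmult_lt_0_compat; auto. Qed.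
Lemma lprod_nonneg l f : (forall x, In x l -> 0 <= f x) -> 0 <= lprod l f.
Proof. induction l; simpl; intros H; [lra|]. apply Rmult_le_pos; auto. Qed.

Lemma lsum_swap l1 l2 (f : nat -> nat -> R) :
  lsum l1 (fun i => lsum l2 (fun j => f i j)) =
  lsum l2 (fun j => lsum l1 (fun i => f i j)).
Proof.
  induction l1; simpl; [now rewrite lsum_zero|].
  rewrite IHl1, <- lsum_plus. reflexivity.
Qed.

Lemma lsum_single l w a : NoDup l -> In w l ->
  lsum l (fun v => if Nat.eqb v w then a else 0) = a.
Proof.
  induction l as [|x l IH]; simpl; intros Hn Hi; [contradiction|].
  inversion Hn; subst. destruct (Nat.eqb_spec x w).
  - subst. rewrite (lsum_ext _ _ (fun _ => 0)), lsum_zero; [lra|].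
    intros y Hy. destruct (Nat.eqb_spec y w); subst; tauto.
  - destruct Hi as [Hi|Hi]; [congruence|]. rewrite IH; auto; lra.
Qed.

Lemma lprod_single l w a : NoDup l -> In w l ->
  lprod l (fun v => if Nat.eqb v w then a else 1) = a.
Proof.
  induction l as [|x l IH]; simpl; intros Hn Hi; [contradiction|].
  inversion Hn; subst. destruct (Nat.eqb_spec x w).
  - subst. rewrite (lprod_ext _ _ (fun _ => 1)), lprod_one; [lra|].
    intros y Hy. destruct (Nat.eqb_spec y w); subst; tauto.
  - destruct Hi as [Hi|Hi]; [congruence|]. rewrite IH; auto; lra.
Qed.

Lemma lsum_split l w f : NoDup l -> In w l ->
  lsum l f = f w + lsum l (fun t => if Nat.eqb t w then 0 else f t).
Proof.
  intros Hn Hw. rewrite <- (lsum_single l w (f w) Hn Hw), <- lsum_plus.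
  apply lsum_ext. intros x _. destruct (Nat.eqb_spec x w); subst; ring.
Qed.
Lemma lprod_split l w f : NoDup l -> In w l ->
  lprod l f = f w * lprod l (fun t => if Nat.eqb t w then 1 else f t).
Proof.
  intros Hn Hw. rewrite <- (lprod_single l w (f w) Hn Hw), <- lprod_mult.
  apply lprod_ext. intros x _. destruct (Nat.eqb_spec x w); subst; ring.
Qed.
Lemma lsumn_split l w f : NoDup l -> In w l ->
  lsumn l f = (f w + lsumn l (fun t => if Nat.eqb t w then 0 else f t))%nat.
Proof.
  induction l as [|x l IH]; simpl; intros Hn Hw; [contradiction|].
  inversion Hn; subst. destruct (Nat.eqb_spec x w).
  - subst. f_equal. apply lsumn_ext.
    intros y Hy. destruct (Nat.eqb_spec y w); subst; tauto.
  - destruct Hw as [Hw|Hw]; [congruence|]. rewrite IH; auto. lia.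
Qed.

Lemma INR_length_filter (p : nat -> bool) l :
  INR (length (filter p l)) = lsum l (fun c => if p c then 1 else 0).
Proof.
  induction l as [|x l IH]; [reflexivity|]. simpl.
  destruct (p x); cbn [length]; [rewrite S_INR|]; rewrite IH; ring.
Qed.

Lemma in_seq0 K x : In x (seq 0 K) <-> (x < K)%nat.
Proof. rewrite in_seq. lia. Qed.

Lemma vsum_ext K f g : (forall x, (x < K)%nat -> f x = g x) -> vsum K f = vsum K g.
Proof. intros H. apply lsum_ext. intros x Hx. apply H, in_seq0, Hx. Qed.
Lemma vprod_ext K f g : (forall x, (x < K)%nat -> f x = g x) -> vprod K f = vprod K g.
Proof. intros H. apply lprod_ext. intros x Hx. apply H, in_seq0, Hx. Qed.
Lemma vsumn_ext K f g : (forall x, (x < K)%nat -> f x = g x) -> vsumn K f = vsumn K g.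
Proof. intros H. apply lsumn_ext. intros x Hx. apply H, in_seq0, Hx. Qed.

Lemma vsum_plus K f g : vsum K (fun x => f x + g x) = vsum K f + vsum K g.
Proof. apply lsum_plus. Qed.
Lemma vsum_minus K f g : vsum K (fun x => f x - g x) = vsum K f - vsum K g.
Proof. apply lsum_minus. Qed.
Lemma vsum_scal K c f : vsum K (fun x => c * f x) = c * vsum K f.
Proof. apply lsum_scal. Qed.
Lemma vsum_zero K : vsum K (fun _ => 0) = 0.
Proof. apply lsum_zero. Qed.
Lemma vsum_swap K L (f : nat -> nat -> R) :
  vsum K (fun i => vsum L (fun j => f i j)) = vsum L (fun j => vsum K (fun i => f i j)).
Proof. apply lsum_swap. Qed.
Lemma vprod_mult K f g : vprod K (fun x => f x * g x) = vprod K f * vprod K g.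
Proof. apply lprod_mult. Qed.
Lemma vprod_pow K (x : R) g : vprod K (fun v => x ^ g v) = x ^ vsumn K g.
Proof. apply lprod_pow. Qed.
Lemma INR_vsumn K g : INR (vsumn K g) = vsum K (fun t => INR (g t)).
Proof. apply INR_lsumn. Qed.

Lemma vprod_pos K f : (forall x, (x < K)%nat -> 0 < f x) -> 0 < vprod K f.
Proof. intros H. apply lprod_pos. intros x Hx. apply H, in_seq0, Hx. Qed.
Lemma vprod_nonneg K f : (forall x, (x < K)%nat -> 0 <= f x) -> 0 <= vprod K f.
Proof. intros H. apply lprod_nonneg. intros x Hx. apply H, in_seq0, Hx. Qed.

Lemma vsum_single K w a : (w < K)%nat ->
  vsum K (fun v => if Nat.eqb v w then a else 0) = a.
Proof. intros. apply lsum_single; [apply seq_NoDup | apply in_seq0; auto]. Qed.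
Lemma vprod_single K w a : (w < K)%nat ->
  vprod K (fun v => if Nat.eqb v w then a else 1) = a.
Proof. intros. apply lprod_single; [apply seq_NoDup | apply in_seq0; auto]. Qed.
Lemma vsum_split K w f : (w < K)%nat ->
  vsum K f = f w + vsum K (fun t => if Nat.eqb t w then 0 else f t).
Proof. intros. apply lsum_split; [apply seq_NoDup | apply in_seq0; auto]. Qed.
Lemma vprod_split K w f : (w < K)%nat ->
  vprod K f = f w * vprod K (fun t => if Nat.eqb t w then 1 else f t).
Proof. intros. apply lprod_split; [apply seq_NoDup | apply in_seq0; auto]. Qed.
Lemma vsumn_split K w f : (w < K)%nat ->
  vsumn K f = (f w + vsumn K (fun t => if Nat.eqb t w then 0 else f t))%nat.
Proof. intros. apply lsumn_split; [apply seq_NoDup | apply in_seq0; auto]. Qed.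

(** * Series of nonnegative terms and iterated box sums *)

Definition psum (M : nat) (g : nat -> R) : R := lsum (seq 0 (S M)) g.

Lemma psum_S M g : psum (S M) g = psum M g + g (S M).
Proof. unfold psum. rewrite seq_S, lsum_app. simpl. lra. Qed.

Lemma psum_shift M g : psum (S M) g = g 0%nat + psum M (fun j => g (S j)).
Proof.
  unfold psum. change (seq 0 (S (S M))) with (0%nat :: seq 1 (S M)).
  rewrite <- seq_shift. generalize (seq 0 (S M)). intros l.
  unfold lsum. simpl. f_equal. induction l as [|x l IH]; simpl; [reflexivity|].
  f_equal. apply IH.
Qed.

Lemma psum_nonneg M g : (forall j, 0 <= g j) -> 0 <= psum M g.
Proof. intros. apply lsum_nonneg; auto. Qed.

Lemma psum_mono M M' g : (forall j, 0 <= g j) -> (M <= M')%nat -> psum M g <= psum M' g.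
Proof. intros Hg H. induction H; [lra|]. rewrite psum_S. specialize (Hg (S m)). lra. Qed.

Lemma psum_cv_term_0 (g : nat -> R) L : Un_cv (fun M => psum M g) L -> Un_cv g 0.
Proof.
  intros H eps He. destruct (H (eps/2)) as [N HN]; [lra|]. exists (S N). intros n Hn.
  destruct n; [lia|]. pose proof (HN (S n) ltac:(lia)) as H1. pose proof (HN n ltac:(lia)) as H2.
  rewrite psum_S in H1. unfold R_dist in *. rewrite Rminus_0_r.
  apply Rabs_def2 in H1; apply Rabs_def2 in H2. apply Rabs_def1; lra.
Qed.

Lemma psum_cv_fin J (a : nat -> nat -> R) (g : nat -> R) :
  (forall j, Un_cv (a j) (g j)) -> Un_cv (fun M => psum J (fun j => a j M)) (psum J g).
Proof.
  induction J; intros H.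
  - unfold psum. simpl. rewrite Rplus_0_r.
    eapply Un_cv_ext; [|apply H]. intros M. simpl. lra.
  - eapply Un_cv_ext; [intros M; symmetry; apply (psum_S J (fun j => a j M))|].
    rewrite psum_S. apply CV_plus; auto.
Qed.

Lemma cv_const c : Un_cv (fun _ => c) c.
Proof. intros e He; exists 0%nat; intros; unfold R_dist; rewrite Rminus_diag, Rabs_R0; auto. Qed.

Lemma cv_scal (u : nat -> R) L c : Un_cv u L -> Un_cv (fun M => c * u M) (c * L).
Proof. intros H. apply CV_mult; [apply cv_const | exact H]. Qed.

Lemma cv_eq u u' L L' : (forall M, u M = u' M) -> L = L' -> Un_cv u' L' -> Un_cv u L.
Proof. intros Hu -> Hcv. eapply Un_cv_ext; [|exact Hcv]. intros; symmetry; auto. Qed.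

Lemma cv_nonneg u L : (forall n, 0 <= u n) -> Un_cv u L -> 0 <= L.
Proof.
  intros Hu Hc. destruct (Rle_lt_dec 0 L); auto.
  destruct (Hc (-L)) as [N HN]; [lra|]. specialize (HN N (le_n _)). specialize (Hu N).
  unfold R_dist in HN. rewrite Rabs_right in HN by lra. lra.
Qed.

(** [isum l M f] sums [f] over the states whose coordinates in [l] range over
    [0..M], the other coordinates being [0]; the head of [l] is the outermost
    summation. *)
Fixpoint isum (l : list nat) (M : nat) (f : (nat -> nat) -> R) : R :=
  match l with
  | [] => f (fun _ => 0%nat)
  | a :: l' => psum M (fun j => isum l' M (fun n => f (upd n a j)))
  end.

Lemma isum_ext l M f g : (forall n, f n = g n) -> isum l M f = isum l M g.
Proof. intros H. replace g with f; auto. apply functional_extensionality; auto. Qed.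

Lemma isum_scal l M c f : isum l M (fun m => c * f m) = c * isum l M f.
Proof.
  revert f. induction l; intros f; simpl; auto.
  unfold psum. rewrite <- lsum_scal. apply lsum_ext. intros. apply IHl.
Qed.

Lemma isum_nonneg l M f : (forall n, 0 <= f n) -> 0 <= isum l M f.
Proof.
  revert f; induction l; intros f Hf; simpl; auto.
  apply psum_nonneg. intros; apply IHl; auto.
Qed.

Lemma isum_mono l M M' f :
  (forall n, 0 <= f n) -> (M <= M')%nat -> isum l M f <= isum l M' f.
Proof.
  revert f; induction l; intros f Hf HM; simpl; [lra|].
  apply Rle_trans with (psum M (fun j => isum l M' (fun n => f (upd n a j)))).
  - apply lsum_le. intros; apply IHl; auto.
  - apply psum_mono; auto. intros; apply isum_nonneg; auto.
Qed.

Lemma bsum_isum d M f : bsum d M f = isum (rev (seq 0 d)) M f.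
Proof.
  revert f. induction d; intros f; [reflexivity|].
  rewrite seq_S, rev_app_distr. cbn [rev app isum bsum]. unfold psum, lsum.
  induction (seq 0 (S M)) as [|x s IHs]; simpl; auto. rewrite IHs, IHd. reflexivity.
Qed.

Lemma upd_comm n a b i j : a <> b -> upd (upd n b j) a i = upd (upd n a i) b j.
Proof.
  intros H. apply functional_extensionality. intros u. unfold upd.
  destruct (Nat.eqb_spec u a), (Nat.eqb_spec u b); subst; auto. congruence.
Qed.

Lemma isum_perm l l' M f : NoDup l -> Permutation l l' -> isum l M f = isum l' M f.
Proof.
  intros Hn Hp. revert f. induction Hp; intros f; simpl; auto.
  - inversion Hn; subst. apply lsum_ext. intros. apply IHHp; auto.
  - inversion Hn; subst. assert (x <> y) by (intro; subst; simpl in *; tauto).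
    unfold psum. rewrite lsum_swap. apply lsum_ext; intros j _. apply lsum_ext; intros i _.
    apply isum_ext. intros n. rewrite upd_comm; auto.
  - rewrite IHHp1 by auto. apply IHHp2. eapply Permutation_NoDup; eauto.
Qed.

(* Tonelli: for nonnegative terms the box sums over [a :: l] converge to the
   series of the limits of the inner box sums. *)
Lemma isum_cons_cv a l f (g : nat -> R) L :
  (forall n, 0 <= f n) ->
  (forall j, Un_cv (fun M => isum l M (fun n => f (upd n a j))) (g j)) ->
  Un_cv (fun M => psum M g) L ->
  Un_cv (fun M => isum (a :: l) M f) L.
Proof.
  intros Hf Hg HL. simpl.
  set (inner := fun j M => isum l M (fun n => f (upd n a j))).
  assert (Hgrow : forall j, Un_growing (inner j)).
  { intros j M. apply isum_mono; auto. }
  assert (Hg0 : forall j, 0 <= g j).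
  { intros j. eapply cv_nonneg; [|apply Hg]. intros; apply isum_nonneg; auto. }
  assert (HLb : forall M, psum M g <= L).
  { apply growing_ineq; auto. intros M. rewrite psum_S. specialize (Hg0 (S M)); lra. }
  intros eps Heps.
  destruct (HL (eps/2)) as [J HJ]; [lra|]. specialize (HJ J (le_n _)).
  destruct (psum_cv_fin J inner g Hg (eps/2)) as [M0 HM0]; [lra|].
  exists (Nat.max M0 J). intros M HM. specialize (HM0 M ltac:(lia)).
  assert (Hup : psum M (fun j => inner j M) <= L).
  { eapply Rle_trans; [|apply (HLb M)]. apply lsum_le. intros j _.
    apply growing_ineq; [apply Hgrow | apply Hg]. }
  assert (Hlow : psum J (fun j => inner j M) <= psum M (fun j => inner j M)).
  { apply psum_mono; [intros; apply isum_nonneg; auto | lia]. }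
  pose proof (HLb J). unfold R_dist in *. subst inner; simpl in *.
  apply Rabs_def1; apply Rabs_def2 in HJ; apply Rabs_def2 in HM0; lra.
Qed.

(** * The negative binomial series *)

Lemma C_nn n : C n n = 1.
Proof. unfold C. rewrite Nat.sub_diag. simpl. field. apply INR_fact_neq_0. Qed.
Lemma C_n0 n : C n 0 = 1.
Proof. unfold C. rewrite Nat.sub_0_r. simpl. field. apply INR_fact_neq_0. Qed.

Lemma C_nonneg n k : 0 <= C n k.
Proof.
  unfold C. apply Rle_mult_inv_pos; [apply pos_INR|].
  apply Rmult_lt_0_compat; apply INR_fact_lt_0.
Qed.

Lemma C_pos n k : (k <= n)%nat -> 0 < C n k.
Proof.
  intros. unfold C. apply Rdiv_lt_0_compat; [apply INR_fact_lt_0|].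
  apply Rmult_lt_0_compat; apply INR_fact_lt_0.
Qed.

Lemma INR_S_neq_0 n : INR (S n) <> 0.
Proof. rewrite S_INR. pose proof (pos_INR n). lra. Qed.

Lemma C_absorb i s : INR (S i) * C (S i + s) (S i) = INR (S s) * C (S i + s) i.
Proof.
  unfold C. replace (S i + s - S i)%nat with s by lia.
  replace (S i + s - i)%nat with (S s) by lia. rewrite !fact_simpl, !mult_INR.
  pose proof (INR_fact_neq_0 i). pose proof (INR_fact_neq_0 s).
  pose proof (INR_S_neq_0 i). pose proof (INR_S_neq_0 s). field; tauto.
Qed.

Lemma C_S_S n s : C (S s) (S n) * (INR (S n) / INR (S s)) = C s n.
Proof.
  unfold C. replace (S s - S n)%nat with (s - n)%nat by lia. rewrite !fact_simpl, !mult_INR.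
  pose proof (INR_fact_neq_0 n). pose proof (INR_fact_neq_0 s).
  pose proof (INR_fact_neq_0 (s - n)). pose proof (INR_S_neq_0 n). pose proof (INR_S_neq_0 s).
  field. tauto.
Qed.

Lemma C_S_l n s : (n <= s)%nat -> C (S s) n * (INR (S s - n) / INR (S s)) = C s n.
Proof.
  intros H. unfold C. replace (S s - n)%nat with (S (s - n)) by lia.
  rewrite !fact_simpl, !mult_INR.
  pose proof (INR_fact_neq_0 n). pose proof (INR_fact_neq_0 s).
  pose proof (INR_fact_neq_0 (s - n)). pose proof (INR_S_neq_0 (s - n)).
  pose proof (INR_S_neq_0 s). field. tauto.
Qed.

Definition negbin (s : nat) (z : R) (M : nat) := psum M (fun j => C (j + s) j * z ^ j).

Lemma negbin_0 z M : (1 - z) * negbin 0 z M = 1 - z ^ (S M).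
Proof.
  unfold negbin. induction M.
  - unfold psum; simpl. rewrite C_nn. ring.
  - rewrite psum_S, Rmult_plus_distr_l, IHM, Nat.add_0_r, C_nn. simpl. ring.
Qed.

(* Pascal's rule, summed. *)
Lemma negbin_S s z M :
  (1 - z) * negbin (S s) z M = negbin s z M - C (M + S s) M * z ^ (S M).
Proof.
  unfold negbin. induction M.
  - unfold psum; simpl. rewrite !C_n0. ring.
  - rewrite !psum_S, Rmult_plus_distr_l, IHM.
    replace (C (S M + S s) (S M)) with (C (M + S s) M + C (S M + s) (S M)).
    + simpl. ring.
    + replace (S M + s)%nat with (M + S s)%nat by lia. rewrite pascal by lia. f_equal.
Qed.

Lemma negbin_growing s z : 0 <= z -> Un_growing (negbin s z).
Proof.
  intros Hz M. unfold negbin. rewrite psum_S.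
  pose proof (Rmult_le_pos _ _ (C_nonneg (S M + s) (S M)) (pow_le z (S M) Hz)). lra.
Qed.

Lemma pow_cv0 z : 0 <= z < 1 -> Un_cv (fun n => z ^ n) 0.
Proof.
  intros Hz e He. destruct (pow_lt_1_zero z ltac:(rewrite Rabs_right; lra) e He) as [N HN].
  exists N. intros n Hn. unfold R_dist. rewrite Rminus_0_r. apply HN; auto.
Qed.

Lemma negbin_cv s z : 0 <= z < 1 -> Un_cv (negbin s z) (/ (1 - z) ^ (S s)).
Proof.
  intros Hz. induction s.
  - eapply Un_cv_ext.
    { intros M. symmetry. replace (negbin 0 z M) with ((1 - z ^ S M) * / (1 - z)).
      reflexivity. rewrite <- negbin_0. field. lra. }
    replace (/ (1 - z) ^ 1) with ((1 - 0) * / (1 - z)) by (simpl; field; lra).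
    apply CV_mult; [|apply cv_const]. apply CV_minus; [apply cv_const|].
    eapply Un_cv_ext; [|exact (CV_shift' _ 1 _ (pow_cv0 z Hz))].
    intros; simpl. rewrite Nat.add_1_r. reflexivity.
  - assert (Hb : has_ub (negbin (S s) z)).
    { exists (/ (1 - z) ^ S s / (1 - z)). intros x [M HM]. subst x.
      pose proof (growing_ineq _ _ (negbin_growing s z ltac:(lra)) IHs M).
      pose proof (negbin_S s z M).
      pose proof (Rmult_le_pos _ _ (C_nonneg (M + S s) M) (pow_le z (S M) ltac:(lra))).
      apply Rmult_le_reg_l with (1 - z); [lra|]. unfold Rdiv.
      rewrite (Rmult_comm _ (/ (1 - z))), <- Rmult_assoc, Rinv_r by lra. lra. }
    destruct (growing_cv _ (negbin_growing (S s) z ltac:(lra)) Hb) as [L HL].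
    assert (Hlast : Un_cv (fun M => C (M + S s) M * z ^ S M) 0).
    { replace 0 with (0 * z) by ring.
      eapply Un_cv_ext; [|apply (CV_mult _ _ _ _ (psum_cv_term_0 _ _ HL) (cv_const z))].
      intros M. simpl. ring. }
    assert (HL2 : Un_cv (fun M => (1 - z) * negbin (S s) z M) (/ (1 - z) ^ S s - 0)).
    { eapply Un_cv_ext; [intros M; symmetry; apply negbin_S|]. apply CV_minus; auto. }
    pose proof (UL_sequence _ _ _ HL2 (cv_scal _ _ (1 - z) HL)) as Heq.
    replace (/ (1 - z) ^ S (S s)) with L; auto.
    apply Rmult_eq_reg_l with (1 - z); [|lra]. rewrite <- Heq. simpl.
    field. split; [apply pow_nonzero|]; lra.
Qed.

Definition negbin_mean (s : nat) (z : R) (M : nat) :=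
  psum M (fun j => INR j * (C (j + s) j * z ^ j)).

Lemma negbin_mean_cv s z : 0 <= z < 1 ->
  Un_cv (negbin_mean s z) (INR (S s) * z * / (1 - z) ^ (S (S s))).
Proof.
  intros Hz. intros eps He.
  destruct (cv_scal _ _ (INR (S s) * z) (negbin_cv (S s) z Hz) eps He) as [N HN].
  exists (S N). intros [|M] HM; [lia|].
  replace (negbin_mean s z (S M)) with (INR (S s) * z * negbin (S s) z M); [apply HN; lia|].
  unfold negbin_mean, negbin. rewrite psum_shift, INR_0, Rmult_0_l, Rplus_0_l.
  unfold psum. rewrite <- lsum_scal. apply lsum_ext. intros j _.
  rewrite <- (Rmult_assoc (INR (S j))), C_absorb.
  replace (S j + s)%nat with (j + S s)%nat by lia. simpl pow. ring.
Qed.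

(** * Ancestors in the tree *)

Section Tree.
Variables (K : nat) (par : nat -> nat).
Hypothesis Htree : is_tree K par.

Local Open Scope nat_scope.

Definition it k v := Nat.iter k par v.
Definition avoids_root v k := forall j, j < k -> it j v <> 0.
Definition ancP a v := exists k, 1 <= k /\ it k v = a /\ avoids_root v k.

Lemma it_add k m v : it (k + m) v = it k (it m v).
Proof. apply Nat.iter_add. Qed.
Lemma it_S k v : it (S k) v = it k (par v).
Proof. replace (S k) with (k + 1) by lia. rewrite it_add. reflexivity. Qed.

Lemma par_lt t : 0 < t < K -> par t < K.
Proof. destruct Htree as [_ [H _]]. apply H. Qed.

Lemma it_lt v k : v < K -> avoids_root v k -> forall j, j <= k -> it j v < K.
Proof.
  intros Hv Hok j. induction j; intros Hj; [exact Hv|].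
  change (par (it j v) < K). apply par_lt.
  split; [|apply IHj; lia]. pose proof (Hok j ltac:(lia)). lia.
Qed.

Lemma it_cycle_avoids_root v i j : i < j -> it i v = it j v ->
  (forall t, i <= t < j -> it t v <> 0) -> forall t, i <= t -> it t v <> 0.
Proof.
  intros Hij Heq Hnz.
  assert (Hq : forall q, it (j + q) v = it (i + q) v).
  { intros q. rewrite (Nat.add_comm j), (Nat.add_comm i), !it_add, Heq. reflexivity. }
  intros t. induction t as [t IH] using (well_founded_induction lt_wf). intros Ht.
  destruct (Nat.lt_ge_cases t j); [apply Hnz; lia|].
  replace t with (j + (t - j)) by lia. rewrite Hq. apply IH; lia.
Qed.

Lemma it_reaches_root v : v < K -> exists m, it m v = 0.
Proof. destruct Htree as [_ [_ H]]. apply H. Qed.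

(* Pigeonhole: the vertices visited before the root are distinct and non-root. *)
Lemma avoids_root_lt v k : v < K -> avoids_root v k -> k < K.
Proof.
  intros Hv Hok. destruct (it_reaches_root v Hv) as [m Hm].
  assert (Hdist : forall i j, i < j < k -> it i v <> it j v).
  { intros i j Hij Heq.
    assert (m >= k) by (destruct (Nat.lt_ge_cases m k); auto; exfalso; apply (Hok m); auto).
    eapply (it_cycle_avoids_root v i j); [lia | exact Heq | | | exact Hm];
      [intros; apply Hok|]; lia. }
  assert (HN : NoDup (map (fun j => it j v) (seq 0 k))).
  { clear Hm. induction k; [constructor|]. rewrite seq_S, map_app.
    apply Permutation_NoDup with (it k v :: map (fun j => it j v) (seq 0 k)).
    - apply Permutation_cons_append.
    - constructor.
      + intros Hin. apply in_map_iff in Hin. destruct Hin as [x [Hx Hin]].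
        apply in_seq in Hin. apply (Hdist x k); auto. lia.
      + apply IHk; [intros j Hj; apply Hok | intros; apply Hdist]; lia. }
  assert (Hinc : incl (map (fun j => it j v) (seq 0 k)) (seq 1 (K - 1))).
  { intros x Hx. apply in_map_iff in Hx. destruct Hx as [j [Hj Hin]]. apply in_seq in Hin.
    subst. apply in_seq. pose proof (Hok j ltac:(lia)).
    pose proof (it_lt v k Hv Hok j ltac:(lia)). lia. }
  pose proof (NoDup_incl_length HN Hinc). rewrite length_map, !length_seq in H.
  destruct Htree. lia.
Qed.

Lemma is_ancP a v : v < K -> is_anc K par a v = true <-> ancP a v.
Proof.
  intros Hv. unfold is_anc. rewrite existsb_exists. split.
  - intros [k [Hk Hb]]. apply in_seq in Hk. apply andb_prop in Hb. destruct Hb as [H1 H2].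
    apply Nat.eqb_eq in H1. rewrite forallb_forall in H2. exists k. do 2 (split; [auto; lia|]).
    intros j Hj. specialize (H2 j). rewrite in_seq in H2. specialize (H2 ltac:(lia)).
    apply Bool.negb_true_iff, Nat.eqb_neq in H2. auto.
  - intros [k [Hk [Ha Hok]]]. pose proof (avoids_root_lt v k Hv Hok). exists k. split.
    + apply in_seq; lia.
    + apply andb_true_intro; split; [apply Nat.eqb_eq; auto|].
      apply forallb_forall. intros j Hj. apply in_seq in Hj.
      apply Bool.negb_true_iff, Nat.eqb_neq, Hok; lia.
Qed.

Lemma ancP_lt a v : v < K -> ancP a v -> a < K.
Proof. intros Hv [k [Hk [Ha Hok]]]. subst. apply (it_lt v k Hv Hok). lia. Qed.

Lemma ancP_irrefl v : v < K -> ~ ancP v v.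
Proof.
  intros Hv [k [Hk [Ha Hok]]]. destruct (it_reaches_root v Hv) as [m Hm].
  eapply (it_cycle_avoids_root v 0 k); [lia | simpl; auto | | | exact Hm];
    [intros; apply Hok|]; lia.
Qed.

Lemma ancP_trans a b c : ancP a b -> ancP b c -> ancP a c.
Proof.
  intros [k2 [H2 [Ha Hok2]]] [k1 [H1 [Hb Hok1]]]. exists (k2 + k1). split; [lia|].
  split; [rewrite it_add, Hb; auto|].
  intros j Hj. destruct (Nat.lt_ge_cases j k1); [apply Hok1; auto|].
  replace j with ((j - k1) + k1) by lia. rewrite it_add, Hb. apply Hok2; lia.
Qed.

Lemma ancP_chain a b u : ancP a u -> ancP b u -> a = b \/ ancP a b \/ ancP b a.
Proof.
  intros [ka [Ha [Hau Hoka]]] [kb [Hb [Hbu Hokb]]].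
  destruct (Nat.lt_trichotomy ka kb) as [Hl|[He|Hl]].
  - right; right. exists (kb - ka). split; [lia|]. rewrite <- Hau, <- it_add.
    split; [replace (kb - ka + ka) with kb by lia; auto|].
    intros j Hj. rewrite <- it_add. apply Hokb; lia.
  - left. subst. auto.
  - right; left. exists (ka - kb). split; [lia|]. rewrite <- Hbu, <- it_add.
    split; [replace (ka - kb + kb) with ka by lia; auto|].
    intros j Hj. rewrite <- it_add. apply Hoka; lia.
Qed.

Lemma ancP_parent a t : 0 < t < K -> (ancP a t <-> a = par t \/ ancP a (par t)).
Proof.
  intros Ht. split.
  - intros [[|[|k]] [Hk [Ha Hok]]]; [lia | left; auto|].
    right. exists (S k). split; [lia|]. rewrite <- it_S.
    split; [auto | intros j Hj; rewrite <- it_S; apply Hok; lia].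
  - intros [H|[k [Hk [Ha Hok]]]].
    + exists 1. split; [lia|]. split; [auto|]. intros j Hj. replace j with 0 by lia. simpl; lia.
    + exists (S k). split; [lia|]. split; [rewrite it_S; auto|].
      intros [|j] Hj; [simpl; lia|]. rewrite it_S. apply Hok; lia.
Qed.

Notation anc := (is_anc K par).
Notation ancq := (is_anc_eq K par).

Lemma is_anc_lt a v : v < K -> anc a v = true -> a < K.
Proof. intros Hv H. apply (ancP_lt a v Hv), is_ancP; auto. Qed.

Lemma is_anc_irrefl v : v < K -> anc v v = false.
Proof.
  intros Hv. destruct (anc v v) eqn:E; auto.
  apply is_ancP in E; auto. exfalso; apply (ancP_irrefl v Hv E).
Qed.

Lemma is_anc_trans a b c : c < K -> anc a b = true -> anc b c = true -> anc a c = true.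
Proof.
  intros Hc H1 H2. pose proof (is_anc_lt _ _ Hc H2) as Hb.
  apply is_ancP in H1; apply is_ancP in H2; auto. apply is_ancP; eauto using ancP_trans.
Qed.

Lemma is_anc_chain a b u : u < K -> anc a u = true -> anc b u = true ->
  a = b \/ anc a b = true \/ anc b a = true.
Proof.
  intros Hu H1 H2. pose proof (is_anc_lt _ _ Hu H1). pose proof (is_anc_lt _ _ Hu H2).
  apply is_ancP in H1; apply is_ancP in H2; auto.
  destruct (ancP_chain a b u H1 H2) as [H3|[H3|H3]]; auto;
    right; [left|right]; apply is_ancP; auto.
Qed.

Lemma is_anc_root a : anc a 0 = false.
Proof.
  destruct (anc a 0) eqn:E; auto. destruct Htree as [HK _].
  apply is_ancP in E; [|lia]. destruct E as [k [Hk [_ Hok]]].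
  exfalso. apply (Hok 0); [lia | reflexivity].
Qed.

Lemma is_anc_parent a t : 0 < t < K -> anc a t = ancq a (par t).
Proof.
  intros Ht. pose proof (par_lt t Ht) as Hp. unfold is_anc_eq.
  destruct (anc a t) eqn:E.
  - apply is_ancP, ancP_parent in E; try lia.
    destruct E as [->|E]; [rewrite Nat.eqb_refl; auto|].
    apply is_ancP in E; auto. rewrite E, orb_true_r. auto.
  - symmetry. apply orb_false_iff. split.
    + apply Nat.eqb_neq. intros ->.
      assert (ancP (par t) t) as H by (apply ancP_parent; auto).
      apply is_ancP in H; [congruence | lia].
    + destruct (anc a (par t)) eqn:E2; auto. apply is_ancP in E2; auto.
      assert (ancP a t) as H by (apply ancP_parent; auto).
      apply is_ancP in H; [congruence | lia].
Qed.

Definition depth v := length (filter (fun a => anc a v) (seq 0 K)).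

Lemma length_filter_lt (l : list nat) (p q : nat -> bool) :
  (forall x, In x l -> p x = true -> q x = true) ->
  (exists x, In x l /\ q x = true /\ p x = false) ->
  length (filter p l) < length (filter q l).
Proof.
  intros H1 [x [Hx [Hq Hp]]].
  induction l as [|y l IH]; [contradiction|].
  assert (Hle : forall l', (forall x, In x l' -> p x = true -> q x = true) ->
                           length (filter p l') <= length (filter q l')).
  { clear. induction l' as [|z l' IH']; simpl; intros H; auto.
    destruct (p z) eqn:E; [rewrite (H z (or_introl eq_refl) E); simpl; apply le_n_S|];
      [|destruct (q z); simpl; [apply le_S|]]; apply IH'; auto. }
  simpl. destruct Hx as [<-|Hx].
  - rewrite Hp, Hq. simpl. apply le_n_S. apply Hle; simpl in H1; auto.
  - destruct (p y) eqn:E; [rewrite (H1 y (or_introl eq_refl) E); simpl; apply le_n_S|];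
      [|destruct (q y); simpl; [apply le_S|]]; apply IH; simpl in H1; auto.
Qed.

Lemma depth_lt a v : v < K -> anc a v = true -> depth a < depth v.
Proof.
  intros Hv Ha. pose proof (is_anc_lt a v Hv Ha). apply length_filter_lt.
  - intros x Hx Hxa. apply in_seq in Hx. eapply is_anc_trans; eauto; lia.
  - exists a. rewrite in_seq, is_anc_irrefl by auto. repeat split; auto; lia.
Qed.

Fixpoint insert_by (key : nat -> nat) (x : nat) (l : list nat) : list nat :=
  match l with
  | [] => [x]
  | y :: l' => if Nat.leb (key y) (key x) then x :: l else y :: insert_by key x l'
  end.
Fixpoint sort_by (key : nat -> nat) (l : list nat) : list nat :=
  match l with [] => [] | x :: l' => insert_by key x (sort_by key l') end.

Lemma insert_by_perm key x l : Permutation (insert_by key x l) (x :: l).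
Proof.
  induction l; simpl; auto. destruct (Nat.leb (key a) (key x)); auto.
  eapply perm_trans; [apply perm_skip, IHl | apply perm_swap].
Qed.

Lemma sort_by_perm key l : Permutation (sort_by key l) l.
Proof. induction l; simpl; auto. eapply perm_trans; [apply insert_by_perm | auto]. Qed.

Lemma sort_by_sorted key l :
  StronglySorted (fun a b => key b <= key a) (sort_by key l).
Proof.
  induction l as [|x l IH]; simpl; [constructor|].
  induction IH as [|y l' Hs IHs Hf]; simpl; [repeat constructor|].
  rewrite Forall_forall in Hf. destruct (Nat.leb_spec (key y) (key x)).
  - constructor; [constructor; [|apply Forall_forall]; auto|].
    constructor; [lia|]. apply Forall_forall. intros z Hz. specialize (Hf z Hz). lia.
  - constructor; auto. apply Forall_forall. intros z Hz.
    apply (Permutation_in _ (insert_by_perm key x l')) in Hz.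
    destruct Hz as [<-|Hz]; auto. lia.
Qed.

(* Deepest vertices first, so that every vertex comes before its ancestors. *)
Definition topo := sort_by depth (seq 0 K).

Lemma in_topo t : In t topo <-> t < K.
Proof.
  rewrite <- in_seq0.
  split; apply Permutation_in; [|apply Permutation_sym]; apply sort_by_perm.
Qed.

(* [summation_order T]: summing out the coordinates of [T], last first, only
   ever sums out a vertex whose ancestors have already been summed out. *)
Definition summation_order (T : list nat) : Prop :=
  NoDup T /\ (forall t, In t T -> t < K) /\
  (forall t a, In t T -> anc a t = true -> In a T) /\
  StronglySorted (fun x y => depth y <= depth x) T.

Record next_vertex (w : nat) (T : list nat) : Prop := {
  nv_lt : w < K;
  nv_notin : ~ In w T;
  nv_closed : forall t a, In t T -> anc a t = true -> In a T;
  nv_anc : forall a, anc a w = true -> In a T }.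

Lemma summation_order_cons w T :
  summation_order (w :: T) -> summation_order T /\ next_vertex w T.
Proof.
  intros [Hn [Hl [Hcl Hs]]]. inversion Hn; subst.
  apply StronglySorted_inv in Hs. destruct Hs as [Hs Hf]. rewrite Forall_forall in Hf.
  assert (Hw : w < K) by (apply Hl; left; auto).
  assert (HclT : forall t a, In t T -> anc a t = true -> In a T).
  { intros t a Ht Ha. destruct (Hcl t a (or_intror Ht) Ha) as [<-|E]; auto.
    pose proof (Hf t Ht). pose proof (depth_lt w t (Hl t (or_intror Ht)) Ha). lia. }
  split; [repeat split|constructor]; auto.
  - intros; apply Hl; right; auto.
  - intros a Ha. destruct (Hcl w a (or_introl eq_refl) Ha) as [<-|E]; auto.
    rewrite is_anc_irrefl in Ha; auto. discriminate.
Qed.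

Lemma topo_summation_order : summation_order topo.
Proof.
  repeat split.
  - eapply Permutation_NoDup; [apply Permutation_sym, sort_by_perm | apply seq_NoDup].
  - intros t Ht. apply in_topo; auto.
  - intros t a Ht Ha. apply in_topo. apply in_topo in Ht. eapply is_anc_lt; eauto.
  - apply sort_by_sorted.
Qed.

End Tree.

(** * Summing out the coordinates one vertex at a time *)

Section Summation.
Variables (K : nat) (par : nat -> nat) (rho : nat -> R).
Hypothesis Htree : is_tree K par.
Hypothesis Hrho : forall v, (v < K)%nat -> 0 < rho v.
Hypothesis Hsub : forall v, (v < K)%nat -> sumAbar K par rho v < 1.

Notation anc := (is_anc K par).
Notation ancq := (is_anc_eq K par).
Notation sumA' := (sumA K par rho).
Notation sumAbar' := (sumAbar K par rho).
Notation subtot' := (subtot K par).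

Lemma sumAbar_sumA v : (v < K)%nat -> sumAbar' v = rho v + sumA' v.
Proof.
  intros Hv. unfold sumAbar, sumA.
  rewrite (vsum_split K v _ Hv), (vsum_split K v (fun a => if anc a v then _ else _) Hv).
  unfold is_anc_eq. rewrite Nat.eqb_refl, (is_anc_irrefl K par Htree) by auto.
  simpl. f_equal. rewrite Rplus_0_l.
  apply vsum_ext. intros x Hx. destruct (Nat.eqb_spec x v); auto.
Qed.

Lemma one_minus_sumA_pos v : (v < K)%nat -> 0 < 1 - sumA' v.
Proof.
  intros Hv. pose proof (Hsub v Hv). pose proof (Hrho v Hv).
  rewrite sumAbar_sumA in H; auto. lra.
Qed.
Lemma one_minus_sumAbar_pos v : (v < K)%nat -> 0 < 1 - sumAbar' v.
Proof. intros Hv. pose proof (Hsub v Hv). lra. Qed.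

Definition memb (T : list nat) (u : nat) : bool := existsb (Nat.eqb u) T.

Lemma membP T u : memb T u = true <-> In u T.
Proof.
  unfold memb. rewrite existsb_exists. split.
  - intros [x [Hx He]]. apply Nat.eqb_eq in He. subst; auto.
  - intros H. exists u. split; auto. apply Nat.eqb_refl.
Qed.
Lemma memb_cons w T u : memb (w :: T) u = (Nat.eqb u w || memb T u)%bool.
Proof. reflexivity. Qed.
Lemma memb_false T u : ~ In u T -> memb T u = false.
Proof. intros H. destruct (memb T u) eqn:E; auto. apply membP in E. contradiction. Qed.

Definition sumA_in (T : list nat) (u : nat) : R :=
  vsum K (fun a => if (anc a u && memb T a)%bool then rho a else 0).

Lemma sumA_in_nil u : sumA_in [] u = 0.
Proof.
  unfold sumA_in. simpl.
  rewrite (vsum_ext _ _ (fun _ => 0)), vsum_zero by (intros; rewrite andb_false_r; auto).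
  reflexivity.
Qed.

Definition c_factor (t : nat) : R := (1 - sumA' t) / (1 - sumAbar' t).

(* After summing out the coordinates in [T], the unnormalised product form
   [weight [] n] becomes [weight T n]. *)
Definition weight_factor (T : list nat) (n : nat -> nat) (t : nat) : R :=
  if memb T t then c_factor t
  else (rho t / (1 - sumA_in T t)) ^ (n t) * C (subtot' n t) (n t).
Definition weight (T : list nat) (n : nat -> nat) : R := vprod K (weight_factor T n).

(* Likewise, summing out [T] turns [INR (n v) * weight [] n] into
   [mean_factor T v n * weight T n]. *)
Definition mean_term (T : list nat) (v : nat) (n : nat -> nat) (t : nat) : R :=
  (if (memb T t && ancq v t)%bool then / (1 - sumAbar' t) else 0)
  - (if (memb T t && anc v t)%bool then / (1 - sumA' t) else 0)
  + (if (negb (memb T t) && anc v t)%bool then INR (n t) / (1 - sumA_in T t) else 0).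
Definition mean_factor (T : list nat) (v : nat) (n : nat -> nat) : R :=
  if memb T v then rho v * vsum K (mean_term T v n) else INR (n v).

Definition override (T : list nat) (m n : nat -> nat) : nat -> nat :=
  fun u => if memb T u then m u else n u.

Definition subtree_load (w : nat) (n : nat -> nat) : nat :=
  vsumn K (fun d => if anc w d then n d else 0%nat).

Section SumOutVertex.
Variables (w : nat) (T : list nat).
Hypothesis Hnext : next_vertex K par w T.

Let Hw : (w < K)%nat := nv_lt K par w T Hnext.

Lemma memb_next : memb T w = false.
Proof. apply memb_false, (nv_notin _ _ _ _ Hnext). Qed.

Lemma next_not_anc_in t : In t T -> anc w t = false.
Proof.
  intros Ht. destruct (anc w t) eqn:E; auto. exfalso.
  apply (nv_notin _ _ _ _ Hnext). eapply (nv_closed _ _ _ _ Hnext); eauto.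
Qed.

Lemma notin_not_anc_next t : ~ In t T -> anc t w = false.
Proof.
  intros Hn. destruct (anc t w) eqn:E; auto.
  exfalso. apply Hn, (nv_anc _ _ _ _ Hnext), E.
Qed.

Lemma sumA_in_next : sumA_in T w = sumA' w.
Proof.
  unfold sumA_in, sumA. apply vsum_ext. intros a Ha.
  destruct (anc a w) eqn:E; simpl; auto.
  replace (memb T a) with true; auto. symmetry. apply membP, (nv_anc _ _ _ _ Hnext), E.
Qed.

Lemma anc_desc_next a t : (t < K)%nat -> In a T -> anc w t = true -> anc a t = anc a w.
Proof.
  intros Ht Ha Hwt. destruct (anc a w) eqn:E; [eapply is_anc_trans; eauto|].
  destruct (anc a t) eqn:E2; auto. exfalso.
  destruct (is_anc_chain K par Htree a w t Ht E2 Hwt) as [<-|[H|H]];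
    [apply (nv_notin _ _ _ _ Hnext); auto | congruence |].
  apply (nv_notin _ _ _ _ Hnext). eapply (nv_closed _ _ _ _ Hnext); eauto.
Qed.

Lemma sumA_in_desc t : (t < K)%nat -> anc w t = true -> sumA_in T t = sumA' w.
Proof.
  intros Ht Hwt. rewrite <- sumA_in_next. unfold sumA_in. apply vsum_ext. intros a Ha.
  destruct (memb T a) eqn:E; [|rewrite !andb_false_r; auto].
  rewrite (anc_desc_next a t Ht (proj1 (membP T a) E) Hwt). reflexivity.
Qed.

Lemma sumA_in_cons_desc t : (t < K)%nat -> anc w t = true ->
  sumA_in (w :: T) t = sumAbar' w.
Proof.
  intros Ht Hwt. rewrite sumAbar_sumA, <- (sumA_in_desc t Ht Hwt) by auto.
  rewrite <- (vsum_single K w (rho w) Hw) at 1. unfold sumA_in. rewrite <- vsum_plus.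
  apply vsum_ext. intros a Ha. rewrite memb_cons. destruct (Nat.eqb_spec a w).
  - subst. rewrite Hwt, memb_next. simpl. ring.
  - simpl. ring.
Qed.

Lemma sumA_in_cons_nondesc t : anc w t = false -> sumA_in (w :: T) t = sumA_in T t.
Proof.
  intros Hwt. unfold sumA_in. apply vsum_ext. intros a Ha. rewrite memb_cons.
  destruct (Nat.eqb_spec a w); subst; auto. rewrite Hwt; auto.
Qed.

Lemma subtot_upd_other n j t : t <> w -> anc t w = false ->
  subtot' (upd n w j) t = subtot' n t.
Proof.
  intros Htw Hanc. unfold subtot. apply vsumn_ext. intros d Hd. unfold upd.
  destruct (Nat.eqb_spec d w); subst; auto. unfold is_anc_eq. rewrite Hanc.
  destruct (Nat.eqb_spec t w); [congruence | auto].
Qed.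

Lemma subtot_upd_next n j : subtot' (upd n w j) w = (j + subtree_load w n)%nat.
Proof.
  unfold subtot, subtree_load. rewrite (vsumn_split K w _ Hw).
  unfold is_anc_eq at 1. rewrite Nat.eqb_refl. simpl.
  unfold upd at 1. rewrite Nat.eqb_refl. f_equal. apply vsumn_ext. intros d Hd.
  unfold is_anc_eq. destruct (Nat.eqb_spec d w) as [->|Hdw].
  - rewrite (is_anc_irrefl K par Htree); auto.
  - destruct (Nat.eqb_spec w d); [congruence|]. unfold upd.
    destruct (Nat.eqb_spec d w); [congruence | auto].
Qed.

Definition zeta := rho w / (1 - sumA' w).
Definition weight_rest (n : nat -> nat) :=
  vprod K (fun t => if Nat.eqb t w then 1 else weight_factor T n t).

Lemma zeta_range : 0 <= zeta < 1.
Proof.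
  pose proof (one_minus_sumA_pos w Hw). pose proof (one_minus_sumAbar_pos w Hw).
  pose proof (Hrho w Hw). rewrite sumAbar_sumA in H0 by auto. unfold zeta. split.
  - apply Rlt_le, Rdiv_lt_0_compat; lra.
  - apply Rmult_lt_reg_r with (1 - sumA' w); auto.
    unfold Rdiv. rewrite Rmult_assoc, Rinv_l by lra. lra.
Qed.

Lemma inv_one_minus_zeta_pow k : / (1 - zeta) ^ k = c_factor w ^ k.
Proof.
  pose proof (one_minus_sumA_pos w Hw). pose proof (one_minus_sumAbar_pos w Hw).
  rewrite <- pow_inv. f_equal. unfold c_factor, zeta. rewrite sumAbar_sumA in * by auto.
  field. lra.
Qed.

Lemma weight_upd_next n j :
  weight T (upd n w j) = (C (j + subtree_load w n) j * zeta ^ j) * weight_rest n.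
Proof.
  unfold weight, weight_rest. rewrite (vprod_split K w _ Hw). f_equal.
  - unfold weight_factor. rewrite memb_next, sumA_in_next, subtot_upd_next.
    unfold upd. rewrite Nat.eqb_refl. unfold zeta. ring.
  - apply vprod_ext. intros t Ht. destruct (Nat.eqb_spec t w); auto. unfold weight_factor.
    destruct (memb T t) eqn:E; auto.
    rewrite subtot_upd_other; auto.
    + unfold upd. destruct (Nat.eqb_spec t w); [congruence | auto].
    + apply notin_not_anc_next. intros Hin. apply membP in Hin. congruence.
Qed.

(* Summing out [w] multiplies the weight of each strict descendant of [w] by
   [c_factor w] per unit of load; these factors are collected here. *)
Lemma weight_cons n :
  weight (w :: T) n = c_factor w * c_factor w ^ (subtree_load w n) * weight_rest n.
Proof.
  unfold weight, weight_rest. rewrite (vprod_split K w _ Hw).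
  unfold weight_factor at 1. rewrite memb_cons, Nat.eqb_refl. simpl.
  rewrite Rmult_assoc. f_equal. unfold subtree_load.
  rewrite <- vprod_pow, <- vprod_mult. apply vprod_ext. intros t Ht.
  destruct (Nat.eqb_spec t w) as [->|Htw].
  - rewrite (is_anc_irrefl K par Htree) by auto. simpl. ring.
  - unfold weight_factor. rewrite memb_cons. destruct (Nat.eqb_spec t w); [congruence|]. simpl.
    destruct (memb T t) eqn:E.
    + rewrite next_not_anc_in by (apply membP; auto). simpl. ring.
    + destruct (anc w t) eqn:Ew.
      * rewrite sumA_in_cons_desc, sumA_in_desc by auto.
        rewrite <- Rmult_assoc, <- Rpow_mult_distr. do 2 f_equal.
        pose proof (one_minus_sumA_pos w Hw). pose proof (one_minus_sumAbar_pos w Hw).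
        unfold c_factor. field. lra.
      * rewrite sumA_in_cons_nondesc by auto. simpl. ring.
Qed.

Lemma weight_affine_series_cv n (a b : R) :
  Un_cv (fun M => psum M (fun j => (a + b * INR j) * weight T (upd n w j)))
    ((a * / (1 - zeta) ^ (S (subtree_load w n))
      + b * (INR (S (subtree_load w n)) * zeta * / (1 - zeta) ^ (S (S (subtree_load w n)))))
     * weight_rest n).
Proof.
  eapply Un_cv_ext.
  2: { apply CV_mult; [|apply cv_const].
       apply CV_plus; apply cv_scal; [apply negbin_cv | apply negbin_mean_cv];
         apply zeta_range. }
  intros M. simpl. unfold negbin, negbin_mean, psum.
  rewrite <- !lsum_scal, <- lsum_plus, Rmult_comm, <- lsum_scal.
  apply lsum_ext. intros j _. rewrite weight_upd_next. ring.
Qed.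

Lemma weight_sum_out n :
  Un_cv (fun M => psum M (fun j => weight T (upd n w j))) (weight (w :: T) n).
Proof.
  eapply cv_eq; [| |apply (weight_affine_series_cv n 1 0)].
  - intros M. apply lsum_ext. intros. ring.
  - rewrite weight_cons, inv_one_minus_zeta_pow. simpl. ring.
Qed.

Lemma mean_term_upd_other T' v n j t : t <> w ->
  mean_term T' v (upd n w j) t = mean_term T' v n t.
Proof.
  intros H. unfold mean_term, upd. destruct (Nat.eqb_spec t w); [congruence | auto].
Qed.

Lemma sum_mean_term_next n :
  vsum K (mean_term (w :: T) w n) = (1 + INR (subtree_load w n)) / (1 - sumAbar' w).
Proof.
  rewrite (vsum_split K w _ Hw). unfold mean_term at 1.
  rewrite memb_cons, Nat.eqb_refl. unfold is_anc_eq. rewrite Nat.eqb_refl.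
  rewrite (is_anc_irrefl K par Htree) by auto. simpl.
  unfold subtree_load. rewrite INR_vsumn. unfold Rdiv. rewrite Rmult_plus_distr_r.
  f_equal; [ring|]. rewrite Rmult_comm, <- vsum_scal. apply vsum_ext. intros t Ht.
  destruct (Nat.eqb_spec t w) as [->|Htw].
  - rewrite (is_anc_irrefl K par Htree); auto. simpl. ring.
  - unfold mean_term. rewrite memb_cons. unfold is_anc_eq.
    destruct (Nat.eqb_spec t w); [congruence|]. destruct (Nat.eqb_spec w t); [congruence|].
    simpl. destruct (memb T t) eqn:E.
    + rewrite next_not_anc_in by (apply membP; auto). simpl. ring.
    + simpl. destruct (anc w t) eqn:E2; [|simpl; ring].
      rewrite sumA_in_cons_desc by auto. unfold Rdiv. ring.
Qed.

Lemma sum_mean_term_upd v n j : In v T ->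
  vsum K (mean_term T v (upd n w j)) =
  vsum K (fun t => if Nat.eqb t w then 0 else mean_term T v n t)
  + (if anc v w then / (1 - sumA' w) else 0) * INR j.
Proof.
  intros Hv. rewrite (vsum_split K w _ Hw), Rplus_comm. f_equal.
  - apply vsum_ext. intros t Ht. destruct (Nat.eqb_spec t w); auto.
    apply mean_term_upd_other; auto.
  - unfold mean_term. rewrite memb_next. simpl. unfold upd. rewrite Nat.eqb_refl.
    destruct (anc v w); [rewrite sumA_in_next; unfold Rdiv|]; ring.
Qed.

Lemma sum_mean_term_cons v n : In v T ->
  vsum K (mean_term (w :: T) v n) =
  vsum K (fun t => if Nat.eqb t w then 0 else mean_term T v n t)
  + (if anc v w then 1 else 0) * (1 + INR (subtree_load w n))
    * (/ (1 - sumAbar' w) - / (1 - sumA' w)).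
Proof.
  intros Hv. assert (Hvw : v <> w) by (intros ->; apply (nv_notin _ _ _ _ Hnext); auto).
  set (D := / (1 - sumAbar' w) - / (1 - sumA' w)).
  rewrite (vsum_split K w _ Hw). unfold mean_term at 1. rewrite memb_cons, Nat.eqb_refl.
  unfold is_anc_eq at 1. destruct (Nat.eqb_spec v w); [congruence|]. simpl.
  transitivity ((if anc v w then 1 else 0) * D +
     (vsum K (fun t => if Nat.eqb t w then 0 else mean_term T v n t) +
      vsum K (fun t => (if anc v w then 1 else 0) * D * INR (if anc w t then n t else 0%nat)))).
  2: { unfold subtree_load. rewrite INR_vsumn, vsum_scal. ring. }
  f_equal; [unfold D; destruct (anc v w); ring|].
  rewrite <- vsum_plus. apply vsum_ext. intros t Ht. destruct (Nat.eqb_spec t w) as [->|Htw].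
  - rewrite (is_anc_irrefl K par Htree) by auto. simpl. ring.
  - unfold mean_term. rewrite memb_cons. destruct (Nat.eqb_spec t w); [congruence|]. simpl.
    destruct (memb T t) eqn:E.
    + rewrite next_not_anc_in by (apply membP; auto). simpl. ring.
    + simpl. destruct (anc w t) eqn:E2.
      * rewrite (anc_desc_next v t Ht Hv E2), sumA_in_cons_desc, sumA_in_desc by auto.
        unfold D. rewrite sumAbar_sumA by auto. destruct (anc v w); simpl; unfold Rdiv; ring.
      * rewrite sumA_in_cons_nondesc by auto. simpl. ring.
Qed.

Lemma mean_sum_out v n : (v < K)%nat ->
  Un_cv (fun M => psum M (fun j => mean_factor T v (upd n w j) * weight T (upd n w j)))
        (mean_factor (w :: T) v n * weight (w :: T) n).
Proof.
  intros Hv. pose proof (one_minus_sumA_pos w Hw). pose proof (one_minus_sumAbar_pos w Hw).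
  pose proof (sumAbar_sumA w Hw) as HAb.
  set (s := subtree_load w n).
  unfold mean_factor. rewrite !memb_cons, weight_cons. fold s.
  destruct (Nat.eqb_spec v w) as [->|Hvw]; simpl.
  - eapply cv_eq; [| |apply (weight_affine_series_cv n 0 1)].
    + intros M. apply lsum_ext. intros j _. rewrite memb_next. unfold upd.
      rewrite Nat.eqb_refl. ring.
    + rewrite sum_mean_term_next, !inv_one_minus_zeta_pow. fold s. simpl pow.
      rewrite S_INR. unfold zeta, c_factor. rewrite HAb in *. field. lra.
  - destruct (memb T v) eqn:Emv.
    + assert (HvT : In v T) by (apply membP; auto).
      set (X := vsum K (fun t => if Nat.eqb t w then 0 else mean_term T v n t)).
      set (Y := if anc v w then / (1 - sumA' w) else 0).
      eapply cv_eq; [| |apply (weight_affine_series_cv n (rho v * X) (rho v * Y))].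
      * intros M. apply lsum_ext. intros j _. rewrite sum_mean_term_upd by auto. fold X Y. ring.
      * rewrite sum_mean_term_cons, !inv_one_minus_zeta_pow by auto. fold X s. simpl pow.
        rewrite S_INR. unfold zeta, c_factor, Y. rewrite HAb in *.
        destruct (anc v w); field; lra.
    + eapply cv_eq; [| |apply (weight_affine_series_cv n (INR (n v)) 0)].
      * intros M. apply lsum_ext. intros j _. unfold upd.
        destruct (Nat.eqb_spec v w); [congruence|]. ring.
      * rewrite !inv_one_minus_zeta_pow. fold s. simpl pow. ring.
Qed.

End SumOutVertex.

Lemma override_cons_upd w T m n j : ~ In w T ->
  override (w :: T) (upd m w j) n = override T m (upd n w j).
Proof.
  intros H. apply functional_extensionality. intros u. unfold override, upd.
  rewrite memb_cons. destruct (Nat.eqb_spec u w) as [->|]; simpl; auto.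
  rewrite memb_false; auto.
Qed.

Lemma weight_nil_nonneg n : 0 <= weight [] n.
Proof.
  apply vprod_nonneg. intros t Ht. unfold weight_factor. rewrite sumA_in_nil. simpl.
  apply Rmult_le_pos; [|apply C_nonneg]. apply pow_le.
  pose proof (Hrho t Ht). unfold Rdiv. rewrite Rminus_0_r, Rinv_1. lra.
Qed.

Lemma weight_sums_cv T n0 : summation_order K par T ->
  Un_cv (fun M => isum T M (fun m => weight [] (override T m n0))) (weight T n0).
Proof.
  revert n0. induction T as [|w T IH]; intros n0 HT; [exact (cv_const (weight [] n0))|].
  destruct (summation_order_cons K par Htree w T HT) as [HT' Hnext].
  apply isum_cons_cv with (g := fun j => weight T (upd n0 w j)).
  - intros; apply weight_nil_nonneg.
  - intros j. eapply Un_cv_ext; [|apply (IH (upd n0 w j) HT')]. intros M.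
    apply isum_ext. intros m. rewrite override_cons_upd; auto. apply (nv_notin _ _ _ _ Hnext).
  - apply weight_sum_out; auto.
Qed.

Lemma mean_sums_cv T n0 v : summation_order K par T -> (v < K)%nat ->
  Un_cv (fun M => isum T M (fun m => INR (override T m n0 v) * weight [] (override T m n0)))
        (mean_factor T v n0 * weight T n0).
Proof.
  revert n0. induction T as [|w T IH]; intros n0 HT Hv;
    [exact (cv_const (INR (n0 v) * weight [] n0))|].
  destruct (summation_order_cons K par Htree w T HT) as [HT' Hnext].
  apply isum_cons_cv with (g := fun j => mean_factor T v (upd n0 w j) * weight T (upd n0 w j)).
  - intros; apply Rmult_le_pos; [apply pos_INR | apply weight_nil_nonneg].
  - intros j. eapply Un_cv_ext; [|apply (IH (upd n0 w j) HT' Hv)]. intros M.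
    apply isum_ext. intros m. rewrite override_cons_upd; auto. apply (nv_notin _ _ _ _ Hnext).
  - apply mean_sum_out; auto.
Qed.

(* Reindexing the strict descendants [t] of [v] by their parents produces the
   numbers of children. *)
Lemma sum_strict_desc_by_parent v :
  vsum K (fun t => if anc v t then / (1 - sumA' t) else 0) =
  vsum K (fun u => if ancq v u then INR (nchildren K par u) / (1 - sumAbar' u) else 0).
Proof.
  set (h := fun u => if ancq v u then / (1 - sumAbar' u) else 0).
  assert (Hpar : forall t, (0 < t < K)%nat -> sumA' t = sumAbar' (par t)).
  { intros t Ht. apply vsum_ext. intros a Ha. rewrite (is_anc_parent K par Htree a t Ht). auto. }
  transitivity (vsum K (fun t => if negb (Nat.eqb t 0) then h (par t) else 0)).
  - apply vsum_ext. intros t Ht. destruct (Nat.eqb_spec t 0) as [->|Ht0].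
    + rewrite (is_anc_root K par Htree). auto.
    + simpl. unfold h. rewrite (is_anc_parent K par Htree v t), Hpar by lia. auto.
  - transitivity (vsum K (fun u => vsum K (fun c =>
        h u * (if (negb (Nat.eqb c 0) && Nat.eqb (par c) u)%bool then 1 else 0)))).
    + rewrite vsum_swap. apply vsum_ext. intros c Hc. destruct (Nat.eqb_spec c 0); simpl.
      * symmetry. rewrite (vsum_ext _ _ (fun _ => 0)), vsum_zero; auto. intros. ring.
      * rewrite <- (vsum_single K (par c) (h (par c))) by (apply (par_lt K par Htree); lia).
        apply vsum_ext. intros u Hu.
        destruct (Nat.eqb_spec (par c) u), (Nat.eqb_spec u (par c)); subst; try congruence; ring.
    + apply vsum_ext. intros u Hu. unfold nchildren. rewrite INR_length_filter.
      change (lsum (seq 0 K) ?f) with (vsum K f). rewrite vsum_scal.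
      unfold h. destruct (ancq v u); unfold Rdiv; ring.
Qed.

Lemma c_rho_pos : 0 < c_rho K par rho.
Proof.
  apply vprod_pos. intros t Ht.
  apply Rdiv_lt_0_compat; [apply one_minus_sumA_pos | apply one_minus_sumAbar_pos]; auto.
Qed.

Lemma memb_topo t : (t < K)%nat -> memb (topo K par) t = true.
Proof. intros Ht. apply membP, in_topo, Ht. Qed.

Lemma weight_topo n : weight (topo K par) n = c_rho K par rho.
Proof.
  apply vprod_ext. intros t Ht. unfold weight_factor. rewrite memb_topo; auto.
Qed.

Lemma pi_pf_weight n : pi_pf K par rho n = / c_rho K par rho * weight [] n.
Proof.
  unfold pi_pf, weight. f_equal. apply vprod_ext. intros t Ht.
  unfold weight_factor. rewrite sumA_in_nil. simpl.
  unfold Rdiv. rewrite Rminus_0_r, Rinv_1, Rmult_1_r. reflexivity.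
Qed.

Lemma weight_override_topo m :
  weight [] (override (topo K par) m (fun _ => 0%nat)) = weight [] m.
Proof.
  apply vprod_ext. intros t Ht. unfold weight_factor, subtot, override.
  simpl. rewrite memb_topo by auto. do 2 f_equal. apply vsumn_ext. intros d Hd.
  rewrite memb_topo; auto.
Qed.

Lemma bsum_topo M f : bsum K M f = isum (topo K par) M f.
Proof.
  rewrite bsum_isum. apply isum_perm; [apply NoDup_rev, seq_NoDup|].
  eapply perm_trans; [apply Permutation_sym, Permutation_rev|].
  apply Permutation_sym, sort_by_perm.
Qed.

Lemma pi_pf_total : state_sum K (pi_pf K par rho) 1.
Proof.
  pose proof c_rho_pos.
  pose proof (weight_sums_cv (topo K par) (fun _ => 0%nat) (topo_summation_order K par Htree))
    as Hcv.
  rewrite weight_topo in Hcv.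
  replace 1 with (/ c_rho K par rho * c_rho K par rho) by (field; lra).
  eapply Un_cv_ext; [|apply (cv_scal _ _ _ Hcv)]. intros M.
  rewrite bsum_topo, <- isum_scal. apply isum_ext. intros m.
  rewrite pi_pf_weight, weight_override_topo. reflexivity.
Qed.

Lemma mean_factor_topo v : (v < K)%nat ->
  mean_factor (topo K par) v (fun _ => 0%nat) = rho v * Ssub K par rho v.
Proof.
  intros Hv. unfold mean_factor. rewrite memb_topo by auto. f_equal.
  transitivity (vsum K (fun t => if ancq v t then / (1 - sumAbar' t) else 0)
                - vsum K (fun t => if anc v t then / (1 - sumA' t) else 0)).
  - rewrite <- vsum_minus. apply vsum_ext. intros t Ht. unfold mean_term.
    rewrite memb_topo by auto. simpl. ring.
  - rewrite sum_strict_desc_by_parent. unfold Ssub. rewrite <- vsum_minus.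
    apply vsum_ext. intros t Ht. destruct (ancq v t); unfold Rdiv; ring.
Qed.

Lemma pi_pf_mean v : (v < K)%nat ->
  state_sum K (fun n => INR (n v) * pi_pf K par rho n) (rho v * Ssub K par rho v).
Proof.
  intros Hv. pose proof c_rho_pos.
  pose proof (mean_sums_cv (topo K par) (fun _ => 0%nat) v
                (topo_summation_order K par Htree) Hv) as Hcv.
  rewrite weight_topo, mean_factor_topo in Hcv by auto.
  replace (rho v * Ssub K par rho v)
    with (/ c_rho K par rho * (rho v * Ssub K par rho v * c_rho K par rho)) by (field; lra).
  eapply Un_cv_ext; [|apply (cv_scal _ _ _ Hcv)]. intros M.
  rewrite bsum_topo, <- isum_scal. apply isum_ext. intros m.
  rewrite pi_pf_weight, weight_override_topo. unfold override. rewrite memb_topo by auto. ring.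
Qed.

End Summation.

(** * The Markov chain *)

Section Chain.
Variables (K : nat) (par : nat -> nat) (lam r : nat -> R).
Hypothesis Htree : is_tree K par.
Hypothesis Hlam : forall v, (v < K)%nat -> 0 < lam v.
Hypothesis Hr : forall v, (v < K)%nat -> 0 < r v.
Let rho := fun u => lam u / r u.

Notation anc := (is_anc K par).
Notation ancq := (is_anc_eq K par).
Notation subtot' := (subtot K par).
Notation gamma' := (gamma K par).
Notation rate' := (rate K par lam r).
Notation pi' := (pi_pf K par rho).

(* States are functions on [nat]; only their values on the vertices matter. *)
Definition agree (n m : nat -> nat) : Prop := forall u, (u < K)%nat -> n u = m u.

Lemma agree_refl n : agree n n.
Proof. intros u _; auto. Qed.

Lemma agree_incr n n' v : agree n n' -> agree (incr n v) (incr n' v).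
Proof. intros H u Hu. unfold incr. rewrite H; auto. Qed.
Lemma agree_decr n n' v : agree n n' -> agree (decr n v) (decr n' v).
Proof. intros H u Hu. unfold decr. rewrite H; auto. Qed.

Lemma incr_same n v : incr n v v = (n v + 1)%nat.
Proof. unfold incr. rewrite Nat.eqb_refl. reflexivity. Qed.
Lemma decr_same n v : decr n v v = (n v - 1)%nat.
Proof. unfold decr. rewrite Nat.eqb_refl. reflexivity. Qed.
Lemma incr_other n v u : u <> v -> incr n v u = n u.
Proof. intros H. unfold incr. destruct (Nat.eqb_spec u v); congruence. Qed.
Lemma decr_other n v u : u <> v -> decr n v u = n u.
Proof. intros H. unfold decr. destruct (Nat.eqb_spec u v); congruence. Qed.

Lemma agree_incr_decr n v : (1 <= n v)%nat -> agree n (incr (decr n v) v).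
Proof. intros Hn u Hu. unfold incr, decr. destruct (Nat.eqb_spec u v); subst; lia. Qed.
Lemma agree_decr_incr n v : agree n (decr (incr n v) v).
Proof. intros u Hu. unfold incr, decr. destruct (Nat.eqb_spec u v); lia. Qed.

Lemma agree_incr_pos n m v : agree m (incr n v) -> (v < K)%nat -> (1 <= m v)%nat.
Proof. intros H Hv. rewrite H, incr_same by auto. lia. Qed.

Lemma agree_sym n m : agree n m -> agree m n.
Proof. intros H u Hu. symmetry; auto. Qed.
Lemma agree_trans n m p : agree n m -> agree m p -> agree n p.
Proof. intros H1 H2 u Hu. rewrite H1; auto. Qed.

Lemma state_eqb_spec a b : state_eqb K a b = true <-> agree a b.
Proof.
  unfold state_eqb, agree. rewrite forallb_forall.
  split; intros H u Hu; apply Nat.eqb_eq, H, in_seq0; auto.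
Qed.

Lemma state_eqb_false a b u : (u < K)%nat -> a u <> b u -> state_eqb K a b = false.
Proof.
  intros Hu Hne. destruct (state_eqb K a b) eqn:E; auto.
  apply state_eqb_spec in E. exfalso; apply Hne, E; auto.
Qed.

Lemma state_eqb_agree a a' b b' : agree a a' -> agree b b' ->
  state_eqb K a b = state_eqb K a' b'.
Proof.
  intros Ha Hb. apply eq_true_iff_eq. rewrite !state_eqb_spec.
  split; intros H u Hu; [rewrite <- Ha, <- Hb | rewrite Ha, Hb]; auto.
Qed.

Lemma subtot_agree n n' t : agree n n' -> subtot' n t = subtot' n' t.
Proof. intros H. apply vsumn_ext. intros d Hd. rewrite H; auto. Qed.

Lemma gamma_agree n n' v : (v < K)%nat -> agree n n' -> gamma' n v = gamma' n' v.
Proof.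
  intros Hv H. unfold gamma. rewrite H, (subtot_agree n n' v H) by auto.
  destruct (Nat.eqb (n' v) 0); auto. f_equal. apply vprod_ext. intros a Ha.
  rewrite (subtot_agree n n' a H), H; auto.
Qed.

Lemma pi_agree n n' : agree n n' -> pi' n = pi' n'.
Proof.
  intros H. unfold pi_pf. f_equal. apply vprod_ext. intros t Ht.
  rewrite (subtot_agree n n' t H), H; auto.
Qed.

Lemma rate_agree n n' m m' : agree n n' -> agree m m' -> rate' n m = rate' n' m'.
Proof.
  intros Hn Hm. apply vsum_ext. intros v Hv.
  rewrite (state_eqb_agree m m' (incr n v) (incr n' v)),
    (state_eqb_agree m m' (decr n v) (decr n' v)),
    Hn, (gamma_agree n n' v Hv Hn) by auto using agree_incr, agree_decr.
  reflexivity.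
Qed.

Lemma subtot_self_le n v : (v < K)%nat -> (n v <= subtot' n v)%nat.
Proof.
  intros Hv. unfold subtot. rewrite (vsumn_split K v _ Hv).
  unfold is_anc_eq. rewrite Nat.eqb_refl. simpl. lia.
Qed.

Lemma subtot_anc_le n a v : (v < K)%nat -> anc a v = true -> (n a + n v <= subtot' n a)%nat.
Proof.
  intros Hv Hanc. pose proof (is_anc_lt K par Htree a v Hv Hanc) as Ha.
  unfold subtot. rewrite (vsumn_split K a _ Ha). unfold is_anc_eq. rewrite Nat.eqb_refl. simpl.
  assert (a <> v) by (intros ->; rewrite (is_anc_irrefl K par Htree) in Hanc; auto; discriminate).
  rewrite (vsumn_split K v _ Hv). destruct (Nat.eqb_spec v a); [congruence|].
  rewrite Hanc, orb_true_r. lia.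
Qed.

Lemma subtot_incr n v u : (v < K)%nat ->
  subtot' (incr n v) u = (subtot' n u + (if ancq u v then 1 else 0))%nat.
Proof.
  intros Hv. unfold subtot.
  rewrite (vsumn_split K v (fun d => if ancq u d then incr n v d else 0%nat) Hv),
    (vsumn_split K v (fun d => if ancq u d then n d else 0%nat) Hv).
  rewrite incr_same, (vsumn_ext K _ (fun t => if Nat.eqb t v then 0%nat
                                             else if ancq u t then n t else 0%nat)).
  - destruct (ancq u v); lia.
  - intros t Ht. destruct (Nat.eqb_spec t v); auto. rewrite incr_other; auto.
Qed.

Lemma gamma_pos n v : (v < K)%nat -> (1 <= n v)%nat -> 0 < gamma' n v.
Proof.
  intros Hv Hn. unfold gamma. destruct (Nat.eqb_spec (n v) 0); [lia|].
  apply Rmult_lt_0_compat.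
  - pose proof (subtot_self_le n v Hv). apply Rdiv_lt_0_compat; apply lt_0_INR; lia.
  - apply vprod_pos. intros a Ha. destruct (anc a v) eqn:E; [|lra].
    pose proof (subtot_anc_le n a v Hv E). apply Rdiv_lt_0_compat; apply lt_0_INR; lia.
Qed.

(* Adding a customer at [v] changes only the binomial factors at [v] and at
   its ancestors, and the ratios are exactly the factors of [gamma] at [v]. *)
Lemma product_form_incr n v : (v < K)%nat ->
  vprod K (fun u => rho u ^ incr n v u * C (subtot' (incr n v) u) (incr n v u))
  * gamma' (incr n v) v
  = rho v * vprod K (fun u => rho u ^ n u * C (subtot' n u) (n u)).
Proof.
  intros Hv.
  assert (Hnv : incr n v v = S (n v)) by (unfold incr; rewrite Nat.eqb_refl; lia).
  assert (Hsv : subtot' (incr n v) v = S (subtot' n v)).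
  { rewrite subtot_incr by auto. unfold is_anc_eq. rewrite Nat.eqb_refl. simpl. lia. }
  set (B := fun u => if anc u v
                     then INR (subtot' (incr n v) u - incr n v u) / INR (subtot' (incr n v) u)
                     else 1).
  assert (Hg : gamma' (incr n v) v =
     vprod K (fun u => if Nat.eqb u v then INR (S (n v)) / INR (S (subtot' n v)) else B u)).
  { unfold gamma. rewrite Hnv, Hsv. cbn [Nat.eqb].
    rewrite (vprod_split K v (fun u => if Nat.eqb u v then _ else B u) Hv), Nat.eqb_refl.
    f_equal. apply vprod_ext. intros u Hu.
    destruct (Nat.eqb_spec u v) as [->|]; auto.
    unfold B. rewrite (is_anc_irrefl K par Htree); auto. }
  rewrite Hg, <- vprod_mult, <- (vprod_single K v (rho v) Hv) at 1. rewrite <- vprod_mult.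
  apply vprod_ext. intros u Hu. unfold B. rewrite !subtot_incr by auto. unfold incr, is_anc_eq.
  destruct (Nat.eqb_spec u v) as [->|Huv]; simpl.
  - replace (subtot' n v + 1)%nat with (S (subtot' n v)) by lia.
    replace (n v + 1)%nat with (S (n v)) by lia.
    rewrite <- (C_S_S (n v) (subtot' n v)). simpl. ring.
  - destruct (anc u v) eqn:E; [|rewrite Nat.add_0_r; ring].
    replace (subtot' n u + 1)%nat with (S (subtot' n u)) by lia.
    rewrite <- (C_S_l (n u) (subtot' n u)) by (apply subtot_self_le; auto). ring.
Qed.

Lemma detailed_balance n v : (v < K)%nat ->
  pi' n * lam v = pi' (incr n v) * (r v * gamma' (incr n v) v).
Proof.
  intros Hv. unfold pi_pf.
  replace (lam v) with (r v * rho v) by (unfold rho; field; pose proof (Hr v Hv); lra).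
  transitivity (/ c_rho K par rho * r v *
     (vprod K (fun u => rho u ^ incr n v u * C (subtot' (incr n v) u) (incr n v u))
      * gamma' (incr n v) v)); [rewrite product_form_incr by auto|]; ring.
Qed.

Lemma rate_incr n v : (v < K)%nat -> rate' n (incr n v) = lam v.
Proof.
  intros Hv. unfold rate. rewrite (vsum_split K v _ Hv).
  replace (state_eqb K (incr n v) (incr n v)) with true
    by (symmetry; apply state_eqb_spec, agree_refl).
  rewrite (state_eqb_false (incr n v) (decr n v) v)
    by (rewrite ?incr_same, ?decr_same; auto; lia).
  rewrite andb_false_r, (vsum_ext _ _ (fun _ => 0)), vsum_zero; [ring|].
  intros w Hw. destruct (Nat.eqb_spec w v); auto.
  rewrite (state_eqb_false (incr n v) (incr n w) v), (state_eqb_false (incr n v) (decr n w) v),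
    andb_false_r by (rewrite ?incr_same, ?incr_other, ?decr_other; auto; lia).
  ring.
Qed.

Lemma rate_decr n v : (v < K)%nat -> (1 <= n v)%nat -> rate' n (decr n v) = r v * gamma' n v.
Proof.
  intros Hv Hn. unfold rate. rewrite (vsum_split K v _ Hv).
  rewrite (state_eqb_false (decr n v) (incr n v) v)
    by (rewrite ?incr_same, ?decr_same; auto; lia).
  replace (state_eqb K (decr n v) (decr n v)) with true
    by (symmetry; apply state_eqb_spec, agree_refl).
  replace (Nat.eqb (n v) 0) with false by (symmetry; apply Nat.eqb_neq; lia).
  rewrite (vsum_ext _ _ (fun _ => 0)), vsum_zero; [simpl; ring|].
  intros w Hw. destruct (Nat.eqb_spec w v); auto.
  rewrite (state_eqb_false (decr n v) (incr n w) w), (state_eqb_false (decr n v) (decr n w) v),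
    andb_false_r by (rewrite ?incr_same, ?decr_same, ?incr_other, ?decr_other; auto; lia).
  ring.
Qed.

Lemma rate_zero n m : (forall v, (v < K)%nat -> ~ agree m (incr n v)) ->
  (forall v, (v < K)%nat -> (1 <= n v)%nat -> ~ agree m (decr n v)) -> rate' n m = 0.
Proof.
  intros H1 H2. unfold rate. rewrite (vsum_ext _ _ (fun _ => 0)), vsum_zero; auto. intros v Hv.
  destruct (state_eqb K m (incr n v)) eqn:E;
    [apply state_eqb_spec in E; contradiction (H1 v Hv E)|].
  destruct (Nat.eqb_spec (n v) 0); [simpl; ring|].
  destruct (state_eqb K m (decr n v)) eqn:E2;
    [apply state_eqb_spec in E2; exfalso; apply (H2 v Hv); auto; lia|].
  simpl; ring.
Qed.

(* Rates vanish except between [n] and [n +- e_v], where detailed balance applies. *)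
Lemma pi_reversible : reversible K par lam r pi'.
Proof.
  assert (Hup : forall n m v, (v < K)%nat -> agree m (incr n v) ->
                  pi' n * rate' n m = pi' m * rate' m n).
  { intros n m v Hv HA. pose proof (agree_incr_pos n m v HA Hv) as Hm1.
    assert (HB : agree n (decr m v))
      by (eapply agree_trans; [apply agree_decr_incr | apply agree_decr, agree_sym, HA]).
    rewrite (rate_agree n n m (incr n v) (agree_refl n) HA), rate_incr by auto.
    rewrite (rate_agree m m n (decr m v) (agree_refl m) HB), rate_decr by auto.
    rewrite (pi_agree m (incr n v) HA), (gamma_agree m (incr n v) v Hv HA).
    apply detailed_balance; auto. }
  intros n m Hn Hm.
  destruct (classic (exists v, (v < K)%nat /\ agree m (incr n v))) as [[v [Hv HA]]|nA];
    [apply (Hup n m v Hv HA)|].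
  destruct (classic (exists v, (v < K)%nat /\ agree n (incr m v))) as [[v [Hv HB]]|nB];
    [symmetry; apply (Hup m n v Hv HB)|].
  rewrite (rate_zero n m), (rate_zero m n); [ring | | | |].
  - intros v Hv HB. apply nB. eauto.
  - intros v Hv Hm1 HB. apply nA. exists v. split; auto.
    eapply agree_trans; [apply agree_incr_decr, Hm1 | apply agree_incr, agree_sym, HB].
  - intros v Hv HA. apply nA. eauto.
  - intros v Hv Hn1 HA. apply nB. exists v. split; auto.
    eapply agree_trans; [apply agree_incr_decr, Hn1 | apply agree_incr, agree_sym, HA].
Qed.

Lemma valid_incr n v : valid K n -> (v < K)%nat -> valid K (incr n v).
Proof. intros H Hv u Hu. unfold incr. destruct (Nat.eqb_spec u v); [lia | auto]. Qed.
Lemma valid_decr n v : valid K n -> valid K (decr n v).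
Proof. intros H u Hu. unfold decr. rewrite H by auto. destruct (u =? v)%nat; auto. Qed.

Lemma pi_stationary : stationary K par lam r pi'.
Proof.
  intros m Hm. unfold out_rate. rewrite <- vsum_scal. apply vsum_ext. intros v Hv.
  rewrite (pi_reversible (incr m v) m (valid_incr m v Hm Hv) Hm), rate_incr by auto.
  destruct (Nat.eqb_spec (m v) 0) as [Hm0|Hm0].
  - unfold gamma. rewrite Hm0. simpl. ring.
  - rewrite (pi_reversible (decr m v) m (valid_decr m v Hm) Hm), rate_decr by (auto; lia). ring.
Qed.

Lemma vsumn_decr n v : (v < K)%nat -> (1 <= n v)%nat -> vsumn K n = S (vsumn K (decr n v)).
Proof.
  intros Hv Hn. rewrite (vsumn_split K v n Hv), (vsumn_split K v (decr n v) Hv).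
  unfold decr at 1. rewrite Nat.eqb_refl.
  rewrite (vsumn_ext K (fun t => if Nat.eqb t v then 0%nat else decr n v t)
                       (fun t => if Nat.eqb t v then 0%nat else n t)); [lia|].
  intros t Ht. unfold decr. destruct (Nat.eqb_spec t v); auto.
Qed.

Lemma communicates_with_empty N n : valid K n -> vsumn K n = N ->
  clos_refl_trans _ (step K par lam r) n (fun _ => 0%nat) /\
  clos_refl_trans _ (step K par lam r) (fun _ => 0%nat) n.
Proof.
  revert n. induction N as [|N IH]; intros n Hn HN.
  - replace n with (fun _ : nat => 0%nat); [split; apply rt_refl|].
    apply functional_extensionality. intros u. destruct (Nat.lt_ge_cases u K); [|symmetry; auto].
    rewrite (vsumn_split K u _ H) in HN. lia.
  - destruct (classic (exists v, (v < K)%nat /\ (1 <= n v)%nat)) as [[v [Hv Hv1]]|Hnone].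
    + destruct (IH (decr n v) (valid_decr n v Hn)) as [H1 H2];
        [rewrite (vsumn_decr n v Hv Hv1) in HN; lia|].
      assert (Hdown : rate' n (decr n v) > 0)
        by (rewrite rate_decr by auto; apply Rmult_lt_0_compat; auto using gamma_pos).
      assert (Hup : rate' (decr n v) n > 0).
      { rewrite (rate_agree _ (decr n v) _ (incr (decr n v) v) (agree_refl _)
                   (agree_incr_decr n v Hv1)), rate_incr by auto. apply Hlam, Hv. }
      split; [eapply rt_trans; [|exact H1] | eapply rt_trans; [exact H2|]];
        apply rt_step; repeat split; auto using valid_decr.
    + assert (Hzero : vsumn K n = vsumn K (fun _ => 0%nat)).
      { apply vsumn_ext. intros u Hu. destruct (n u) eqn:E; auto.
        exfalso. apply Hnone. exists u. split; [auto | lia]. }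
      rewrite HN in Hzero. clear -Hzero. exfalso. unfold vsumn in Hzero.
      induction (seq 0 K); simpl in *; [discriminate | auto].
Qed.

Lemma chain_irreducible : irreducible K par lam r.
Proof.
  intros n m Hn Hm. eapply rt_trans.
  - apply (proj1 (communicates_with_empty _ n Hn eq_refl)).
  - apply (proj2 (communicates_with_empty _ m Hm eq_refl)).
Qed.

End Chain.

Theorem theorem2 (K : nat) (par : nat -> nat) (lam r : nat -> R) :
  is_tree K par ->
  (forall v, (v < K)%nat -> 0 < lam v) ->
  (forall v, (v < K)%nat -> 0 < r v) ->
  (forall v, (v < K)%nat -> sumAbar K par (fun u => lam u / r u) v < 1) ->
  let rho := fun u => lam u / r u in
  let pi := pi_pf K par rho in
  irreducible K par lam r /\
  (forall n, valid K n -> 0 < pi n) /\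
  state_sum K pi 1 /\
  stationary K par lam r pi /\
  reversible K par lam r pi /\
  (forall v, (v < K)%nat ->
     let EN := rho v * Ssub K par rho v in
     state_sum K (fun n => INR (n v) * pi n) EN /\
     lam v / EN = r v * / Ssub K par rho v).
Proof.
  intros Htree Hlam Hr Hsub rho pi.
  assert (Hrho : forall v, (v < K)%nat -> 0 < rho v)
    by (intros v Hv; apply Rdiv_lt_0_compat; auto).
  split; [apply chain_irreducible; auto|].
  split.
  { intros n Hn. apply Rmult_lt_0_compat; [apply Rinv_0_lt_compat, c_rho_pos; auto|].
    apply vprod_pos. intros t Ht.
    apply Rmult_lt_0_compat; [apply pow_lt; auto | apply C_pos, subtot_self_le; auto]. }
  split; [apply pi_pf_total; auto|].
  split; [apply pi_stationary; auto|].
  split; [apply pi_reversible; auto|].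
  intros v Hv EN. split; [apply pi_pf_mean; auto|].
  unfold EN, rho. pose proof (Hlam v Hv). pose proof (Hr v Hv).
  destruct (Req_dec (Ssub K par (fun u => lam u / r u) v) 0) as [E|E].
  - rewrite E, Rmult_0_r. unfold Rdiv. rewrite Rinv_0. ring.
  - field. repeat split; lra.
Qed.
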